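(* Consider the equation \[ \sqrt{t \left(1 - \frac{1}{A^2}\right)\left(1 - \frac{1}{x^2}\right)\left(1 - \frac{1}{y^2}\right)\left(1 - \frac{1}{z^2}\right)} = \left(1 + \frac{1}{x}\right)\left(1 + \frac{1}{y}\right)\left(1 + \frac{1}{z}\right). \qquad (\ast) \] (a) There are only finitely many tuples $(t,A,x,y,z)$ of integers, all greater than $1$, with $x\le y\le z$, satisfying $(\ast)$. (b) There are infinitely many tuples $(t,A,x,y,z)$ of integers with $t\neq 0$ and $A,x,y,z\notin\{0,1,-1\}$ satisfying $(\ast)$.
   Context: A perfect Ramanujan identity is an instance of $(\ast)$ in which $t,A,x,y,z$ are all positive integers greater than $1$; a general Ramanujan identity is an instance of $(\ast)$ in which $t,A,x,y,z$ are integers with $t\neq0$ and $A,x,y,z\notin\{0,\pm1\}$. The paper orders the variables so that $x\le y\le z$. *)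

(* Defs.v *)
From mathcomp Require Import all_boot all_order all_algebra.
From mathcomp Require Import boolp classical_sets functions cardinality reals.
Set Implicit Arguments.
Unset Strict Implicit.
Unset Printing Implicit Defensive.
Import Order.TTheory GRing.Theory Num.Theory.
Local Open Scope ring_scope.

(* [Num.sqrt] is [0] on negative numbers. When none of [x], [y], [z] is [-1],
   the right-hand side is nonzero, so this convention creates no solution with
   a negative radicand. *)
Definition ramanujan_eq (R : realType) (t A x y z : int) : Prop :=
  Num.sqrt (t%:~R * (1 - 1 / A%:~R ^+ 2) * (1 - 1 / x%:~R ^+ 2)
              * (1 - 1 / y%:~R ^+ 2) * (1 - 1 / z%:~R ^+ 2))
  = (1 + 1 / x%:~R) * (1 + 1 / y%:~R) * (1 + 1 / z%:~R) :> R.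

Definition perfect_ramanujan (R : realType) (t A x y z : int) : Prop :=
  [/\ 1 < t, 1 < A & [/\ 1 < x, 1 < y & 1 < z]] /\ ramanujan_eq R t A x y z.

Definition general_ramanujan (R : realType) (t A x y z : int) : Prop :=
  [/\ t != 0, A \notin [:: 0; 1; -1] &
      [/\ x \notin [:: 0; 1; -1], y \notin [:: 0; 1; -1]
        & z \notin [:: 0; 1; -1]]]
  /\ ramanujan_eq R t A x y z.

(* Main.v *)
Require Import Defs.
From mathcomp Require Import all_boot all_order all_algebra.
From mathcomp Require Import boolp classical_sets functions cardinality reals.
From mathcomp Require Import zify ring lra.
Set Implicit Arguments.
Unset Strict Implicit.
Unset Printing Implicit Defensive.
Import Order.TTheory GRing.Theory Num.Theory.
Local Open Scope classical_set_scope.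
Local Open Scope ring_scope.

(** Squaring turns the equation into
    [t = A^2/(A^2-1) * (x+1)/(x-1) * (y+1)/(y-1) * (z+1)/(z-1)].
    For perfect identities each factor on the right exceeds 1 and tends to 1,
    and the product is less than 36. The set of products of a fixed number of
    such factors has a gap just below every real number; hence for fixed [t]
    the product of all factors but one stays away from [t] from below, so the
    remaining factor stays away from 1 and its variable is bounded.
    For general identities, the factors of [x] and [y = -x] cancel, and
    [(4, 2, x, -x, 2)] is a solution for every [x]. *)

(** * Gaps in sets of products *)

Definition descends_to_1 (R : realType) (f : nat -> R) : Prop :=
  (forall n, 1 < f n) /\
  (forall e, 1 < e -> exists N, forall n, (N <= n)%N -> f n < e).

(** Equivalently, no strictly increasing sequence in [S] converges. Since [c] is any real, the
    property can be applied at rescaled points such as [c / f n]. *)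
Definition gap_below (R : realType) (S : set R) : Prop :=
  forall c, exists2 d, d < c & forall s, S s -> s < c -> s <= d.

Definition multiples (R : realType) (f : nat -> R) (S : set R) : set R :=
  [set u | exists n s, S s /\ u = f n * s].

Section Gaps.
Variables (R : realType) (f : nat -> R) (S : set R).
Hypotheses (f_desc : descends_to_1 f) (S_gt0 : forall s, S s -> 0 < s).
Hypothesis S_gap : gap_below S.

Lemma descends_gt0 n : 0 < f n.
Proof. exact: lt_trans ltr01 (f_desc.1 n). Qed.

Lemma multiples_gt0 u : multiples f S u -> 0 < u.
Proof. by move=> [n [s [/S_gt0 s0 ->]]]; rewrite mulr_gt0 ?descends_gt0. Qed.

Lemma gap_below_gt0 c : 0 < c ->
  exists d, [/\ 0 < d, d < c & forall s, S s -> s < c -> s <= d].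
Proof.
move=> c0; have [d dc dP] := S_gap c.
exists (Num.max d (c / 2)); split.
- by rewrite lt_max (divr_gt0 c0) ?orbT.
- by rewrite gt_max dc /=; lra.
- by move=> s Ss sc; rewrite le_max dP.
Qed.

(** For one [n], the gap of [S] below [c / f n], scaled by [f n], is a gap below [c]; finitely many
    [n] are combined by a maximum. *)
Lemma gap_below_initial_multiples c N :
  exists2 d, d < c & forall n s, (n < N)%N -> S s -> f n * s < c -> f n * s <= d.
Proof.
elim: N => [|N [d dc dP]]; first by exists (c - 1) => //; lra.
have [d' d'c d'P] := S_gap (c / f N).
exists (Num.max d (f N * d')).
  by rewrite gt_max dc mulrC -ltr_pdivlMr ?descends_gt0.
move=> n s; rewrite ltnS leq_eqVlt le_max => /predU1P[->|nN] Ss lt_c.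
  by rewrite ler_pM2l ?descends_gt0 ?d'P ?orbT // ltr_pdivlMr ?descends_gt0 // mulrC.
by rewrite dP.
Qed.

Lemma gap_below_multiples : gap_below (multiples f S).
Proof.
move=> c; have [c0|c0] := leP c 0.
  exists (c - 1); first by lra.
  by move=> s /multiples_gt0 s0 sc; lra.
have [d [d0 dc dP]] := gap_below_gt0 c0.
(* As [f n > 1], [f n * s < c] forces [s < c], hence [s <= d]. For [n >= N] the product is then
   below the midpoint of [d] and [c]; the finitely many smaller [n] have their own gap [d']. *)
have [|N NP] := f_desc.2 ((d + c) / 2 / d).
  by rewrite ltr_pdivlMr // mul1r; lra.
have [d' d'c d'P] := gap_below_initial_multiples c N.
exists (Num.max ((d + c) / 2) d').
  by rewrite gt_max d'c andbT; lra.
move=> _ [n [s [Ss ->]]] lt_c; rewrite le_max.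
have [nN|Nn] := ltnP n N; first by rewrite d'P ?orbT.
have s0 := S_gt0 Ss.
have s_lt : s < c by apply: le_lt_trans lt_c; rewrite ler_peMl ?ltW ?f_desc.1.
have := NP n Nn; rewrite ltr_pdivlMr // => lt_n.
apply/orP; left; apply: ltW; apply: le_lt_trans lt_n.
by rewrite ler_pM2l ?descends_gt0 ?dP.
Qed.

(** For [c > 0], [f n > 1] gives [s < c], so [s] is at most some [d < c]; then [f n >= c / d > 1],
    which fails for large [n]. *)
Lemma bounded_factor_index c :
  exists N, forall n s, S s -> c = f n * s -> (n < N)%N.
Proof.
have [c0|c0] := leP c 0.
  exists 0 => n s /S_gt0 s0 cE; have := mulr_gt0 (descends_gt0 n) s0.
  by rewrite -cE; lra.
have [d [d0 dc dP]] := gap_below_gt0 c0.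
have [|N NP] := f_desc.2 (c / d); first by rewrite ltr_pdivlMr ?mul1r.
exists N => n s Ss cE; rewrite ltnNge; apply/negP => /NP.
rewrite ltr_pdivlMr // ltNge => /negP; apply.
rewrite {1}cE ler_pM2l ?descends_gt0 // dP // cE ltr_pMl ?S_gt0 //.
exact: f_desc.1.
Qed.

End Gaps.

Lemma gap_below_set1 (R : realType) (a : R) : gap_below [set a].
Proof.
move=> c; have [ac|ca] := ltP a c; first by exists a => // s ->.
by exists (c - 1) => [|s ->]; lra.
Qed.

Lemma uniform_bound (P : nat -> nat -> Prop) :
  (forall t, exists N, forall n, P t n -> (n < N)%N) ->
  forall T, exists N, forall t n, (t < T)%N -> P t n -> (n < N)%N.
Proof.
move=> bP; elim=> [|T [N NP]]; first by exists 0%N.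
have [M MP] := bP T; exists (maxn N M) => t n.
rewrite ltnS leq_eqVlt leq_max => /predU1P[->|tT] Ptn.
  by rewrite (MP _ Ptn) orbT.
by rewrite (NP _ _ tT Ptn).
Qed.

(** * The factors of the squared equation, and the infinite family *)

Section Factors.
Variable R : realType.

(* [(x+1)/(x-1)] at [x = n+2], and [A^2/(A^2-1)] at [A = n+2]. *)
Definition factor_x (n : nat) : R := 1 + 2 / n.+1%:R.
Definition factor_A (n : nat) : R := 1 + 1 / (n.+1%:R * n.+3%:R).

Lemma descends_to_1_le_factor_x (f : nat -> R) :
  (forall n, 1 < f n <= factor_x n) -> descends_to_1 f.
Proof.
move=> fP; split=> [n|e e1]; first by case/andP: (fP n).
(* The bound [2 / n.+1 < e - 1] amounts to [2 / (e - 1) < n.+1]. *)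
exists (Num.trunc (2 / (e - 1))) => n Nn; have /andP[_] := fP n.
move/le_lt_trans; apply; rewrite /factor_x -ltrBrDl ltr_pdivrMr ?ltr0n //.
rewrite mulrC -ltr_pdivrMr ?subr_gt0 //.
by apply: lt_le_trans (truncnS_gt _) _; rewrite ler_nat ltnS.
Qed.

Lemma descends_factor_x : descends_to_1 factor_x.
Proof.
apply: descends_to_1_le_factor_x => n; rewrite lexx andbT /factor_x.
by rewrite ltrDl divr_gt0 ?ltr0n.
Qed.

Lemma factor_A_le n : factor_A n <= factor_x n.
Proof.
rewrite /factor_A /factor_x lerD2l ler_pM ?ler1n ?invr_ge0 ?mulr_ge0 ?ler0n //.
by rewrite lef_pV2 ?posrE ?mulr_gt0 ?ltr0n // ler_peMr ?ler0n // ler1n.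
Qed.

Lemma descends_factor_A : descends_to_1 factor_A.
Proof.
apply: descends_to_1_le_factor_x => n; rewrite factor_A_le andbT /factor_A.
by rewrite ltrDl divr_gt0 ?mulr_gt0 ?ltr0n.
Qed.

(** All variables but [t] are shifted by 2. The nesting down to the final 1 matches iterated
    [multiples] over [[set 1]]. *)
Definition perfect_product (t a x y z : nat) : Prop :=
  t%:R = factor_A a * (factor_x x * (factor_x y * (factor_x z * 1))).

(** The factors are largest at index 0, with values 4/3 for [A] and 3 for the others, so the product
    is at most 36. *)
Lemma perfect_product_t a x y z t :
  perfect_product t a x y z -> (t < 37)%N.
Proof.
have x3 n : 0 <= factor_x n <= 3.
  have le1 : n.+1%:R^-1 <= 1 :> R by rewrite invf_le1 ?ler1n ?ltr0n.
  have : 0 <= n.+1%:R^-1 :> R by rewrite invr_ge0.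
  by rewrite /factor_x; move: _^-1 le1 => v; lra.
have A43 : 0 <= factor_A a <= 4 / 3.
  have ge3 : 3 <= a.+1%:R * a.+3%:R :> R.
    by rewrite -natrM ler_nat; lia.
  have : (a.+1%:R * a.+3%:R)^-1 <= 3^-1 :> R.
    by rewrite lef_pV2 ?posrE //; lra.
  have : 0 <= (a.+1%:R * a.+3%:R)^-1 :> R by rewrite invr_ge0; lra.
  by rewrite /factor_A; move: _^-1 => v; lra.
move=> E; rewrite -(ltr_nat R) E mulr1.
have /andP[x0 xl] := x3 x; have /andP[y0 yl] := x3 y; have /andP[z0 zl] := x3 z.
have /andP[A0 Al] := A43.
apply: (@le_lt_trans _ _ (4 / 3 * (3 * (3 * 3)))); last by lra.
by rewrite !ler_pM ?mulr_ge0.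
Qed.

(** For fixed [t], isolating the factor of [A] or of [x] leaves a cofactor in a set with gaps. As
    [t < 37], the bounds become uniform; symmetry covers [y] and [z]. *)
Lemma perfect_product_bounded :
  exists N, forall t a x y z, perfect_product t a x y z ->
    [/\ (t < N)%N, (a < N)%N, (x < N)%N, (y < N)%N & (z < N)%N].
Proof.
have dx := descends_factor_x; have dA := descends_factor_A.
have g1 : gap_below [set 1 : R] by exact: gap_below_set1.
have p1 : forall s : R, [set 1 : R] s -> 0 < s by move=> s ->.
have m (f : nat -> R) n S s : S s -> multiples f S (f n * s).
  by exists n, s.
set S1 := multiples factor_x [set 1].
have pS1 := multiples_gt0 dx p1; have gS1 := gap_below_multiples dx p1 g1.
have pS2 := multiples_gt0 dx pS1; have gS2 := gap_below_multiples dx pS1 gS1.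
have pS3 := multiples_gt0 dx pS2; have gS3 := gap_below_multiples dx pS2 gS2.
have pSA := multiples_gt0 dA pS2; have gSA := gap_below_multiples dA pS2 gS2.
have [|NA NAP] := @uniform_bound
    (fun t a => exists x y z, perfect_product t a x y z) _ 37.
  move=> t; have [N NP] := bounded_factor_index dA pS3 gS3 t%:R.
  by exists N => a [x [y [z E]]]; apply: (NP _ _ _ E); do 3!apply: (m).
have [|Nx NxP] := @uniform_bound
    (fun t x => exists a y z, perfect_product t a x y z) _ 37.
  move=> t; have [N NP] := bounded_factor_index dx pSA gSA t%:R.
  exists N => x [a [y [z E]]].
  apply: (NP x (factor_A a * (factor_x y * (factor_x z * 1)))).
    by do 3!apply: (m).
  by rewrite E mulrCA.
exists (maxn 37 (maxn NA Nx)) => t a x y z E.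
have t37 := perfect_product_t E.
have Ey : perfect_product t a y x z.
  by rewrite /perfect_product E !mulr1; ring.
have Ez : perfect_product t a z x y.
  by rewrite /perfect_product E !mulr1; ring.
split; rewrite !leq_max.
- by rewrite t37.
- by rewrite (NAP t a) ?orbT //; exists x, y, z.
- by rewrite (NxP t x) ?orbT //; exists a, y, z.
- by rewrite (NxP t y) ?orbT //; exists a, x, z.
- by rewrite (NxP t z) ?orbT //; exists a, x, y.
Qed.

Lemma ramanujan_eq_product (t a x y z : nat) :
  ramanujan_eq R t (Posz a.+2) (Posz x.+2) (Posz y.+2) (Posz z.+2) ->
  perfect_product t a x y z.
Proof.
rewrite /ramanujan_eq /perfect_product /factor_A /factor_x mulr1 -!pmulrn.
have n3 (n : nat) : n.+3%:R = n.+1%:R + 2 :> R by rewrite -natrD addn2.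
have n2 (n : nat) : n.+2%:R = n.+1%:R + 1 :> R by rewrite natr1.
rewrite !n3 !n2.
have p (n : nat) : 0 < n.+1%:R :> R by rewrite ltr0n.
have := p a; have := p x; have := p y; have := p z.
(* Each capital letter is now an original variable minus 1, hence positive. *)
move: a.+1%:R x.+1%:R y.+1%:R z.+1%:R => A X Y Z Z0 Y0 X0 A0.
have pos (u : R) : 0 < u -> 1 - 1 / (u + 1) ^+ 2 = u * (u + 2) / (u + 1) ^+ 2.
  by move=> u0; field; rewrite gt_eqF //; lra.
have ge0 (u : R) : 0 < u -> 0 <= 1 - 1 / (u + 1) ^+ 2.
  by move=> u0; rewrite pos // divr_ge0 ?exprn_ge0 ?mulr_ge0 //; lra.
move/(congr1 (fun r => r ^+ 2)).
rewrite sqr_sqrtr; last by rewrite !mulr_ge0 ?ge0.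
rewrite !pos // => E.
have nz (u : R) : 0 < u -> (u != 0) && (u + 1 != 0) && (u + 2 != 0).
  by move=> u0; rewrite !gt_eqF //; lra.
have /andP[/andP[a0 a1] a2] := nz _ A0.
have /andP[/andP[x0 x1] x2] := nz _ X0.
have /andP[/andP[y0 y1] y2] := nz _ Y0.
have /andP[/andP[z0 z1] z2] := nz _ Z0.
set k := (A * (A + 2) / (A + 1) ^+ 2) * (X * (X + 2) / (X + 1) ^+ 2)
  * (Y * (Y + 2) / (Y + 1) ^+ 2) * (Z * (Z + 2) / (Z + 1) ^+ 2).
have k0 : k != 0 by rewrite /k !mulf_neq0 ?invr_neq0 ?expf_neq0.
apply: (mulIf k0); rewrite {1}/k !mulrA.
rewrite !mulrA in E; rewrite E /k.
by field; rewrite a0 a1 a2 x0 x1 y0 y1 z0 z1.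
Qed.

Lemma ramanujan_eq_opp (n : nat) :
  ramanujan_eq R 4 2 (Posz n.+2) (- Posz n.+2) 2.
Proof.
rewrite /ramanujan_eq rmorphN /= -!pmulrn.
have : 2 <= n.+2%:R :> R by rewrite ler_nat.
move: n.+2%:R => x x2.
have x0 : x != 0 by rewrite gt_eqF //; lra.
have xV : x^-1 ^+ 2 <= 1.
  by rewrite exprVn invf_le1 ?exprn_gt0 ?exprn_ege1 //; lra.
(* The radicand is the square of [r], so only the sign of [r] matters. *)
set r := RHS; have r0 : 0 <= r.
  have -> : r = 3 / 2 * (1 - x^-1 ^+ 2) by rewrite /r; field.
  by rewrite mulr_ge0 //; lra.
rewrite -(ger0_norm r0) -sqrtr_sqr; congr Num.sqrt.
by rewrite /r; field.
Qed.

End Factors.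

Theorem theorem1p2 (R : realType) :
  finite_set [set p : int * int * int * int * int |
    let: (t, A, x, y, z) := p in
    x <= y /\ y <= z /\ perfect_ramanujan R t A x y z] /\
  infinite_set [set p : int * int * int * int * int |
    let: (t, A, x, y, z) := p in general_ramanujan R t A x y z].
Proof.
split.
  have [N NP] := perfect_product_bounded R.
  (* The shifted copy serves [A], [x], [y], [z]; the plain one serves [t]. *)
  pose F := [set Posz n.+2 | n in `I_N] `|` [set Posz n | n in `I_N].
  have finF : finite_set F.
    by rewrite finite_setU; split; apply: finite_image; apply: finite_II.
  have finB : finite_set (F `*` F `*` F `*` F `*` F).
    by do 4!apply: finite_setX => //.
  apply: sub_finite_set finB => -[[[[t A] x] y] z] [_ [_ [[t1 A1 [x1 y1 z1]]]]].
  have shift (u : int) : 1 < u -> exists n, u = Posz n.+2.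
    by move=> u1; exists (`|u|%N - 2)%N; lia.
  have [a ->] := shift _ A1; have [k ->] := shift _ x1.
  have [l ->] := shift _ y1; have [m ->] := shift _ z1.
  have -> : t = Posz `|t|%N by lia.
  move=> /ramanujan_eq_product /NP [tN aN kN lN mN].
  by do !split=> /=; [right; exists `|t|%N | left; exists a | left; exists k
    | left; exists l | left; exists m].
pose h (n : nat) : int * int * int * int * int :=
  (4, 2, Posz n.+2, - Posz n.+2, 2).
move=> fin; apply: infinite_nat.
have hI : injective h by move=> n m [].
apply: sub_finite_set (finite_preimage (f := h) _ fin); last by move=> n m _ _ /hI.
by move=> n _; split; [split | exact: ramanujan_eq_opp].
Qed.
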